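(* Let $w_1,w_2,w_3$ be any positive integers. Then for every integer $n\ge 0$ and every $y_1\in\mathbb{Z}_p$, the following three expressions are equal: \begin{align*} &(w_1w_2)^{n-1}\sum_{a=0}^{dw_1-1}\sum_{b=0}^{dw_2-1}\chi(ab)\,\xi^{w_3(aw_2+bw_1)}B_{n,\chi,\xi^{w_1w_2}}\Big(w_3y_1+\frac{w_3}{w_1}a+\frac{w_3}{w_2}b\Big)\\ =&(w_2w_3)^{n-1}\sum_{a=0}^{dw_2-1}\sum_{b=0}^{dw_3-1}\chi(ab)\,\xi^{w_1(aw_3+bw_2)}B_{n,\chi,\xi^{w_2w_3}}\Big(w_1y_1+\frac{w_1}{w_2}a+\frac{w_1}{w_3}b\Big)\\ =&(w_3w_1)^{n-1}\sum_{a=0}^{dw_3-1}\sum_{b=0}^{dw_1-1}\chi(ab)\,\xi^{w_2(aw_1+bw_3)}B_{n,\chi,\xi^{w_1w_3}}\Big(w_2y_1+\frac{w_2}{w_3}a+\frac{w_2}{w_1}b\Big). \end{align*}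
   Context: Let $p$ be a fixed prime, $\mathbb{Z}_p$ the ring of $p$-adic integers, and $\mathbb{C}_p$ the completion of an algebraic closure of $\mathbb{Q}_p$. Let $\Gamma_r=\{\xi\in\mathbb{C}_p : \xi^{p^s}=1 \text{ for some } s\in\mathbb{Z}_{>0}\}$ (ramified roots of unity) and fix any $\xi\in\Gamma_r$. Let $d$ be a fixed positive integer and $\chi$ a (primitive) Dirichlet character of conductor $d$, viewed as a function $\mathbb{Z}\to\mathbb{C}_p$ via a fixed embedding $\overline{\mathbb{Q}}\to\mathbb{C}_p$ (periodic mod $d$, zero on integers not coprime to $d$; if $d=1$, $\chi\equiv 1$). For $\eta\in\Gamma_r$, the generalized twisted Bernoulli polynomials $B_{n,\chi,\eta}(x)$ attached to $\chi$ and $\eta$ are the polynomials in $x$ with coefficients in $\mathbb{C}_p$ (hence evaluable at any element of $\mathbb{C}_p$) defined by the power series expansion in $t$ $$\frac{te^{xt}}{\eta^{d}e^{dt}-1}\sum_{a=0}^{d-1}\chi(a)\eta^{a}e^{at}=\sum_{n=0}^{\infty}B_{n,\chi,\eta}(x)\frac{t^n}{n!}.$$ *)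

(* Defs.v *)
From HB Require Import structures.
From mathcomp Require Import all_boot all_order all_algebra all_field.
From mathcomp Require Import boolp classical_sets reals.
From mathcomp Require Import zify.

Set Implicit Arguments.
Unset Strict Implicit.
Unset Printing Implicit Defensive.

Import Order.TTheory GRing.Theory Num.Theory.
Local Open Scope ring_scope.

(* ------------------------------------------------------------------------ *)
(* Fields with an absolute value.  The norms of MathComp satisfy            *)
(* `|x *+ n| = `|x| *+ n, which fails p-adically, so an absolute value is a *)
(* plain function to the reals here.                                        *)
(* ------------------------------------------------------------------------ *)

Definition absolute_value (R : realType) (K : fieldType) (v : K -> R) : Prop :=
  [/\ forall x, 0 <= v x,
      forall x, v x = 0 <-> x = 0,
      {morph v : x y / x * y} &
      forall x y, v (x + y) <= v x + v y].

Definition cauchy_for (R : realType) (K : fieldType) (v : K -> R)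
    (u : nat -> K) : Prop :=
  forall e : R, 0 < e -> exists N : nat,
    forall m n : nat, (N <= m)%N -> (N <= n)%N -> v (u m - u n) < e.

Definition converges_for (R : realType) (K : fieldType) (v : K -> R)
    (u : nat -> K) (l : K) : Prop :=
  forall e : R, 0 < e -> exists N : nat,
    forall n : nat, (N <= n)%N -> v (u n - l) < e.

Definition complete_for (R : realType) (K : fieldType) (v : K -> R) : Prop :=
  forall u : nat -> K, cauchy_for v u -> exists l : K, converges_for v u l.

Definition is_completion (R : realType) (K L : fieldType) (v : K -> R)
    (w : L -> R) (f : K -> L) : Prop :=
  [/\ absolute_value w,
      complete_for w,
      forall x, w (f x) = v x &
      forall (y : L) (e : R), 0 < e -> exists x : K, w (y - f x) < e].

Definition padic_abs (R : realType) (p : nat) (q : rat) : R :=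
  if q == 0 then 0
  else (p%:R : R) ^ ((logn p `|denq q|%N)%:Z - (logn p `|numq q|%N)%:Z).

(* ------------------------------------------------------------------------ *)
(* The tower Q -> Q_p -> algebraic closure of Q_p -> C_p.  Each step fixes  *)
(* the next field up to isomorphism, so an inhabitant of this record is the *)
(* field C_p with its absolute value normalised by |p| = 1/p.               *)
(* ------------------------------------------------------------------------ *)

Record padicComplex (R : realType) (p : nat) := PadicComplex {
  Qp : fieldType;
  Qp_abs : Qp -> R;
  Qp_of_rat : {rmorphism rat -> Qp};
  Qp_completion : is_completion (padic_abs R p) Qp_abs Qp_of_rat;

  Qpbar : closedFieldType;
  Qpbar_abs : Qpbar -> R;
  Qpbar_of_Qp : {rmorphism Qp -> Qpbar};
  Qpbar_algebraic : forall x : Qpbar, algebraicOver Qpbar_of_Qp x;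
  Qpbar_absolute_value : absolute_value Qpbar_abs;
  Qpbar_abs_ext : forall x : Qp, Qpbar_abs (Qpbar_of_Qp x) = Qp_abs x;

  Cp :> fieldType;
  Cp_abs : Cp -> R;
  Cp_of_Qpbar : {rmorphism Qpbar -> Cp};
  Cp_completion : is_completion Qpbar_abs Cp_abs Cp_of_Qpbar
}.

Definition padic_integer (R : realType) (p : nat) (C : padicComplex R p)
    (y : C) : Prop :=
  exists2 x : Qp C, Qp_abs x <= 1 & y = Cp_of_Qpbar C (Qpbar_of_Qp C x).

Definition ramified_root_of_unity (p : nat) (K : fieldType) (xi : K) : Prop :=
  exists2 s : nat, (0 < s)%N & xi ^+ (p ^ s) = 1.

(* ------------------------------------------------------------------------ *)
(* Dirichlet characters; algC is the algebraic closure of Q.                *)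
(* ------------------------------------------------------------------------ *)

Definition dirichlet_character (d : nat) (chi : int -> algC) : Prop :=
  [/\ chi 1 = 1,
      {morph chi : a b / a * b},
      forall a : int, chi (a + d%:Z) = chi a &
      forall a : int, (chi a == 0) = ~~ coprimez a d%:Z].

Definition primitive_dirichlet_character (d : nat) (chi : int -> algC) : Prop :=
  dirichlet_character d chi /\
  forall e : nat, (e %| d)%N ->
    (forall a : int, coprimez a d%:Z -> (a = 1 %[mod e%:Z])%Z -> chi a = 1) ->
    e = d.

(* ------------------------------------------------------------------------ *)
(* A formal power series in t is its sequence of coefficients.              *)
(* ------------------------------------------------------------------------ *)

Definition fps_mul (A : nzRingType) (f g : nat -> A) : nat -> A :=
  fun n => \sum_(i < n.+1) f i * g (n - i)%N.

Definition fps_t (A : nzRingType) : nat -> A := fun n => (n == 1%N)%:R.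

(* exp (u t) *)
Definition fps_exp (K : fieldType) (u : {poly K}) : nat -> {poly K} :=
  fun n => (n`!%:R)^-1 *: u ^+ n.

(* eta^d exp (d t) - 1 *)
Definition bernoulli_den (K : fieldType) (d : nat) (eta : K) :
    nat -> {poly K} :=
  fun n => eta ^+ d *: fps_exp (d%:R) n - (n == 0%N)%:R.

(* t exp (x t) \sum_(a < d) chi a eta^a exp (a t), where x is 'X *)
Definition bernoulli_num (K : fieldType) (d : nat) (chi : int -> K) (eta : K) :
    nat -> {poly K} :=
  fps_mul (fps_mul (fps_t _) (fps_exp 'X))
    (fun n => \sum_(0 <= a < d) (chi a%:Z * eta ^+ a) *: fps_exp (a%:R) n).

(* bernoulli_den need not be invertible (its constant term is eta^d - 1), so *)
(* the quotient of power series is expressed by clearing the denominator.    *)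
Definition is_twisted_bernoulli (K : fieldType) (d : nat) (chi : int -> K)
    (eta : K) (B : nat -> {poly K}) : Prop :=
  fps_mul (bernoulli_den d eta) (fun n => (n`!%:R)^-1 *: B n) =1
  bernoulli_num d chi eta.

Definition twisted_bernoulli (K : fieldType) (d : nat) (chi : int -> K)
    (eta : K) : nat -> {poly K} :=
  xget (fun=> 0) (is_twisted_bernoulli d chi eta).

(* Well-definedness: in characteristic 0 there is exactly one such family.  *)
Section WellDefined.
Variable K : fieldType.

Fixpoint fps_quot_seq (v : nat) (c : nat -> K) (F : nat -> {poly K}) (n : nat) :
    seq {poly K} :=
  if n is m.+1 then
    let s := fps_quot_seq v c F m in
    rcons s ((c v)^-1 *:
      (F (m + v)%N - \sum_(j < m) c (m + v - j)%N *: s`_j))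
  else [::].

Lemma size_fps_quot_seq v c F n : size (fps_quot_seq v c F n) = n.
Proof. by elim: n => //= n IHn; rewrite size_rcons IHn. Qed.

Lemma nth_fps_quot_seq v c F n m : (m < n)%N ->
  (fps_quot_seq v c F n)`_m = (fps_quot_seq v c F m.+1)`_m.
Proof.
elim: n => // n IHn; rewrite ltnS leq_eqVlt => /predU1P[->//|lt_mn].
by rewrite [LHS]/= nth_rcons size_fps_quot_seq lt_mn IHn.
Qed.

Lemma fps_quot_exists v (c : nat -> K) (F : nat -> {poly K}) :
    c v != 0 -> (forall i, (i < v)%N -> c i = 0) ->
    (forall i, (i < v)%N -> F i = 0) ->
  exists H, fps_mul (fun n => (c n)%:P) H =1 F.
Proof.
move=> cv0 c0 F0; pose H n := (fps_quot_seq v c F n.+1)`_n; exists H => m.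
have HE n : c v *: H n = F (n + v)%N - \sum_(j < n) c (n + v - j)%N *: H j.
  rewrite {1}/H /= nth_rcons size_fps_quot_seq ltnn eqxx scalerA mulfV //.
  rewrite scale1r; congr (_ - _); apply: eq_bigr => j _.
  by rewrite nth_fps_quot_seq.
rewrite /fps_mul; case: (ltnP m v) => [lt_mv|le_vm].
  rewrite F0 // big1 // => i _; rewrite c0 ?mul0r //.
  by rewrite (leq_ltn_trans _ lt_mv) // -ltnS.
rewrite -(subnK le_vm); set n := (m - v)%N.
pose G j := (c (n + v - j)%N)%:P * H j.
have -> : \sum_(i < (n + v).+1) (c i)%:P * H (n + v - i)%N =
          \sum_(0 <= j < (n + v).+1) G j.
  rewrite big_mkord (reindex_inj rev_ord_inj); apply: eq_bigr => i _ /=.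
  by rewrite subSS /G subKn // -ltnS.
have G0 : \sum_(n.+1 <= j < (n + v).+1) G j = 0.
  rewrite big_nat; apply: big1 => j /andP[lt_nj le_j].
  by rewrite /G c0 ?mul0r //; lia.
have le_n : (n.+1 <= (n + v).+1)%N by rewrite ltnS leq_addr.
rewrite (big_cat_nat (leq0n _) le_n) G0 /= addr0 big_nat_recr //= big_mkord.
rewrite {2}/G addKn mul_polyC HE.
rewrite (eq_bigr (fun j : 'I_n => c (n + v - j)%N *: H j)); last first.
  by move=> j _; rewrite /G mul_polyC.
by rewrite addrC subrK.
Qed.

Lemma fps_quot_unique v (c : nat -> K) (H H' : nat -> {poly K}) :
    c v != 0 -> (forall i, (i < v)%N -> c i = 0) ->
  fps_mul (fun n => (c n)%:P) H =1 fps_mul (fun n => (c n)%:P) H' -> H =1 H'.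
Proof.
move=> cv0 c0 eqHH' n; elim/ltn_ind: n => n IHn.
have := eqHH' (v + n)%N; rewrite /fps_mul.
have lt_v : (v < (v + n).+1)%N by rewrite ltnS leq_addr.
rewrite (bigD1 (Ordinal lt_v)) //= [in RHS](bigD1 (Ordinal lt_v)) //=.
rewrite addKn (eq_bigr (fun i : 'I_(v + n).+1 => (c i)%:P * H' (v + n - i)%N)).
  move/addIr; apply: mulfI; by rewrite polyC_eq0.
move=> i; rewrite -val_eqE /= neq_ltn => /orP[/c0->|lt_vi]; first by rewrite !mul0r.
by rewrite IHn // ltn_subLR ?ltn_add2r // -ltnS.
Qed.

Hypothesis charK : [pchar K] =i pred0.

Let natK_neq0 n : (0 < n)%N -> n%:R != 0 :> K.
Proof. by rewrite lt0n; move/pcharf0P: charK => ->. Qed.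

Variables (d : nat) (chi : int -> K) (eta : K).
Hypotheses (d_gt0 : (0 < d)%N) (eta_neq0 : eta != 0).

Let den n : K := eta ^+ d * (n`!%:R)^-1 * d%:R ^+ n - (n == 0%N)%:R.

Let denE : bernoulli_den d eta = fun n => (den n)%:P.
Proof.
apply/funext => n; rewrite /bernoulli_den /fps_exp /den scalerA.
by rewrite -polyC_natr -[X in _ - X]polyC_natr -polyC_exp -mul_polyC -polyCM polyCB.
Qed.

Let den_val : exists v, [/\ den v != 0, forall i, (i < v)%N -> den i = 0 &
  forall i, (i < v)%N -> bernoulli_num d chi eta i = 0].
Proof.
have [e1|ne1] := eqVneq (eta ^+ d) 1; last first.
  by exists 0; split=> //; rewrite /den expr0 invr1 !mulr1 subr_eq0.
exists 1; split.
- by rewrite /den e1 subr0 invr1 !mul1r expr1 natK_neq0.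
- by case=> // _; rewrite /den e1 invr1 !mul1r expr0 subrr.
- case=> // _; rewrite /bernoulli_num /fps_mul big_ord1 /= big_ord1 /=.
  by rewrite /fps_t !mul0r.
Qed.

Lemma twisted_bernoulliP :
  is_twisted_bernoulli d chi eta (twisted_bernoulli d chi eta).
Proof.
rewrite /twisted_bernoulli; case: xgetP => [B -> //|noB].
have [v [den0 den_lt num_lt]] := den_val.
have [H HP] := fps_quot_exists den0 den_lt num_lt.
case: (noB (fun n => n`!%:R *: H n)) => n.
rewrite -HP denE; apply: eq_bigr => i _.
by rewrite scalerA mulVf ?scale1r // natK_neq0 // fact_gt0.
Qed.

Lemma twisted_bernoulli_unique B :
  is_twisted_bernoulli d chi eta B -> B =1 twisted_bernoulli d chi eta.
Proof.
move=> BP n; have [v [den0 den_lt _]] := den_val.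
have /(fps_quot_unique den0 den_lt)/(_ n) eqB :
    fps_mul (fun n => (den n)%:P) (fun n => (n`!%:R)^-1 *: B n) =1
    fps_mul (fun n => (den n)%:P)
      (fun n => (n`!%:R)^-1 *: twisted_bernoulli d chi eta n).
  by move=> m; rewrite -denE BP twisted_bernoulliP.
by apply: (scalerI _ eqB); rewrite invr_eq0 natK_neq0 ?fact_gt0.
Qed.

End WellDefined.

Lemma Cp_pchar (R : realType) (p : nat) (C : padicComplex R p) :
  [pchar C] =i pred0.
Proof.
move=> q; rewrite (fmorph_pchar (Cp_of_Qpbar C)) (fmorph_pchar (Qpbar_of_Qp C)).
by rewrite (fmorph_pchar (Qp_of_rat C)) Num.Theory.pchar_num.
Qed.

(* Main.v *)
(** With [E = xi e^t] and [S z = \sum_(c < d) chi c z^c], the exponential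
    generating function of the first expression is
      [t e^(w1 w2 w3 y1 t) (E^(d w1 w2 w3) - 1)^2 S(E^(w1 w2)) S(E^(w2 w3)) S(E^(w3 w1))
       / ((E^(d w1 w2) - 1) (E^(d w2 w3) - 1) (E^(d w3 w1) - 1))],
    because the periodicity of [chi] turns the sum over [a < d w1] into a
    geometric sum times [S(E^(w2 w3))], and likewise for [b].  This is symmetric
    in the weights.  The denominators need not be invertible power series, but
    they are nonzero, hence cancellable. *)
Require Import Defs.
From HB Require Import structures.
From mathcomp Require Import all_boot all_order all_algebra all_field.
From mathcomp Require Import boolp classical_sets reals.
From mathcomp Require Import ring.

Set Implicit Arguments.
Unset Strict Implicit.
Unset Printing Implicit Defensive.

Import Order.TTheory GRing.Theory Num.Theory.
Local Open Scope ring_scope.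

(** A name distinct from the bare function type, so that its ring product is the Cauchy product
    [fps_mul] and not a pointwise one. *)
Definition fps (A : Type) : Type := nat -> A.

(** * Formal power series as a commutative ring *)

Section FpsZmodule.
Variable A : zmodType.

HB.instance Definition _ := gen_eqMixin (fps A).
HB.instance Definition _ := gen_choiceMixin (fps A).

Definition fps_zero : fps A := fun=> 0.
Definition fps_opp (f : fps A) : fps A := fun n => - f n.
Definition fps_add (f g : fps A) : fps A := fun n => f n + g n.

Fact fps_addA : associative fps_add.
Proof. by move=> f g h; apply/funext => n; exact: addrA. Qed.
Fact fps_addC : commutative fps_add.
Proof. by move=> f g; apply/funext => n; exact: addrC. Qed.
Fact fps_add0 : left_id fps_zero fps_add.
Proof. by move=> f; apply/funext => n; exact: add0r. Qed.
Fact fps_addN : left_inverse fps_zero fps_opp fps_add.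
Proof. by move=> f; apply/funext => n; exact: addNr. Qed.

HB.instance Definition _ :=
  GRing.isZmodule.Build (fps A) fps_addA fps_addC fps_add0 fps_addN.

Lemma coef_fps_sum I (r : seq I) (P : pred I) (F : I -> fps A) n :
  (\sum_(i <- r | P i) F i) n = \sum_(i <- r | P i) F i n.
Proof. by elim/big_rec2: _ => // i y1 y2 _ <-. Qed.

End FpsZmodule.

Section FpsRing.
Variable A : comNzRingType.
Implicit Types f g h : fps A.

Definition fps_trunc m f : {poly A} := \poly_(i < m) f i.

(** A coefficient of a product depends only on truncations, so commutativity and associativity are
    inherited from [{poly A}]. *)
Lemma coef_fps_mul m f g n : (n < m)%N ->
  fps_mul f g n = (fps_trunc m f * fps_trunc m g)`_n.
Proof.
move=> lt_nm; rewrite coefM; apply: eq_bigr => i _.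
by rewrite !coef_poly !(leq_ltn_trans _ lt_nm) ?leq_subr // -ltnS.
Qed.

Definition fps_const (c : A) : fps A := fun n => if n == 0%N then c else 0.

Lemma coef_fps_constM c f n : fps_mul (fps_const c) f n = c * f n.
Proof.
rewrite /fps_mul big_ord_recl subn0 [X in _ + X]big1 ?addr0 // => i _.
by rewrite mul0r.
Qed.

Fact fps_mulC : commutative (@fps_mul A : fps A -> fps A -> fps A).
Proof.
by move=> f g; apply/funext => n; rewrite !(coef_fps_mul _ _ (ltnSn n)) mulrC.
Qed.
Fact fps_mulA : associative (@fps_mul A : fps A -> fps A -> fps A).
Proof.
move=> f g h; apply/funext => n.
transitivity (fps_trunc n.+1 f * fps_trunc n.+1 g * fps_trunc n.+1 h)`_n.
  rewrite -mulrA coefM; apply: eq_bigr => i _.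
  rewrite coef_poly ltn_ord (@coef_fps_mul n.+1) //.
  by rewrite ltnS leq_subr.
rewrite coefM; apply: eq_bigr => i _.
by rewrite (@coef_fps_mul n.+1) // coef_poly ltnS leq_subr.
Qed.
Fact fps_mul1 : left_id (fps_const 1) (@fps_mul A : fps A -> fps A -> fps A).
Proof. by move=> f; apply/funext => n; rewrite coef_fps_constM mul1r. Qed.
Fact fps_mulDl :
  left_distributive (@fps_mul A : fps A -> fps A -> fps A) (@fps_add A).
Proof.
move=> f g h; apply/funext => n; rewrite /fps_add /fps_mul -big_split /=.
by apply: eq_bigr => i _; rewrite mulrDl.
Qed.
Fact fps_one_neq0 : fps_const 1 != 0 :> fps A.
Proof. by apply/eqP => /(congr1 (@^~ 0%N))/eqP; rewrite /= oner_eq0. Qed.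

HB.instance Definition _ := GRing.Zmodule_isComNzRing.Build (fps A)
  fps_mulA fps_mulC fps_mul1 fps_mulDl fps_one_neq0.

Lemma fps_constM c e : fps_const (c * e) = fps_const c * fps_const e.
Proof.
apply/funext => n; rewrite [RHS]coef_fps_constM /fps_const.
by case: eqP; rewrite ?mulr0.
Qed.

(* The substitution [x := x0, t := w t]. *)
Definition fps_eval (x0 w : A) (F : nat -> {poly A}) : fps A :=
  fun n => w ^+ n * (F n).[x0].

Lemma fps_evalM x0 w F G :
  fps_eval x0 w (fps_mul F G) = fps_eval x0 w F * fps_eval x0 w G.
Proof.
apply/funext => n; rewrite [RHS]/GRing.mul /= /fps_eval /fps_mul horner_sum.
rewrite mulr_sumr; apply: eq_bigr => i _.
have -> : w ^+ n = w ^+ i * w ^+ (n - i) by rewrite -exprD subnKC ?leq_ord.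
rewrite hornerM; ring.
Qed.

End FpsRing.

(** * Exponential series and cancellation *)

Section Exponential.
Variable K : fieldType.
Hypothesis charK : [pchar K] =i pred0.

Lemma natf_neq0_pchar n : (0 < n)%N -> n%:R != 0 :> K.
Proof. by rewrite lt0n; move/pcharf0P: charK => ->. Qed.

Definition fps_expc (u : K) : fps K := fun n => n`!%:R^-1 * u ^+ n.

(** This is the binomial theorem: [n! = 'C(n, i) i! (n - i)!], with factorials invertible in
    characteristic 0. *)
Lemma fps_expcD u v : fps_expc (u + v) = fps_expc u * fps_expc v.
Proof.
apply/funext => n; rewrite [RHS]/GRing.mul /= /fps_expc /fps_mul.
rewrite addrC exprDn mulr_sumr; apply: eq_bigr => i _.
have le_in := leq_ord i.
have n0 k : k`!%:R != 0 :> K by rewrite natf_neq0_pchar ?fact_gt0.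
rewrite -mulr_natr -(bin_fact le_in) !natrM.
have b0 : 'C(n, i)%:R != 0 :> K by rewrite natf_neq0_pchar ?bin_gt0.
by field; rewrite b0 !n0.
Qed.

(* [xi e^t] *)
Definition fps_twist (xi : K) : fps K := fps_const xi * fps_expc 1.

Lemma fps_expc0 : fps_expc 0 = 1.
Proof.
apply/funext => -[|n]; first by rewrite /fps_expc invr1 mulr1.
by rewrite /fps_expc expr0n mulr0.
Qed.

Lemma fps_twistX xi k :
  fps_twist xi ^+ k = fps_const (xi ^+ k) * fps_expc k%:R.
Proof.
elim: k => [|k IHk]; first by rewrite fps_expc0 mulr1.
rewrite exprS IHk exprS fps_constM mulrS fps_expcD /fps_twist; ring.
Qed.

Lemma coef_fps_twistX xi k n :
  (fps_twist xi ^+ k) n = xi ^+ k * (n`!%:R^-1 * k%:R ^+ n).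
Proof. by rewrite fps_twistX [LHS]coef_fps_constM. Qed.

(** Some coefficient of [D] is nonzero, hence there is a lowest one, and [fps_quot_unique] then
    determines the quotient recursively. *)
Lemma fps_mulfI (D : fps K) k : D k != 0 -> injective ( *%R D).
Proof.
move=> Dk f g eqfg.
have [v Dv vmin] := ex_minnP (ex_intro (fun i => D i != 0) k Dk).
have D0 i : (i < v)%N -> D i = 0.
  by move=> lt_iv; apply/eqP; apply: contraTT lt_iv => /vmin; rewrite -leqNgt.
(* [fps_quot_unique] concerns polynomial coefficients, so scalars are embedded as constant
   polynomials. *)
pose P (h : fps K) : nat -> {poly K} := fun n => (h n)%:P.
have PM h n : fps_mul (fun n => (D n)%:P) (P h) n = ((D * h) n)%:P.
  rewrite [in RHS]/GRing.mul /= /fps_mul rmorph_sum.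
  by apply: eq_bigr => i _; rewrite rmorphM.
apply/funext => n; apply: polyC_inj.
by apply: (fps_quot_unique Dv D0 (H := P f) (H' := P g)) => m; rewrite !PM eqfg.
Qed.

(** The constant term [xi^k - 1] may vanish, but the coefficient of [t] is [xi^k k], which does
    not. *)
Lemma fps_twistXB1_mulfI xi k : xi != 0 -> (0 < k)%N ->
  injective ( *%R (fps_twist xi ^+ k - 1)).
Proof.
move=> xi0 k_gt0; apply: (@fps_mulfI _ 1).
rewrite [X in X != 0]/GRing.add /= /fps_add coef_fps_twistX.
rewrite [X in _ + X]/GRing.opp /= /fps_opp oppr0 addr0 invr1 mul1r expr1.
by rewrite mulf_neq0 ?expf_neq0 ?natf_neq0_pchar.
Qed.

End Exponential.

(** * Character sums and the Bernoulli generating function *)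

Section TwistedBernoulli.
Variable K : fieldType.
Hypothesis charK : [pchar K] =i pred0.
Variables (d : nat) (chi : int -> K) (xi : K).
Hypotheses (d_gt0 : (0 < d)%N) (xi_neq0 : xi != 0).
Hypothesis chiM : {morph chi : a b / a * b}.
Hypothesis chi_per : forall a : int, chi (a + d%:Z) = chi a.

Let E := fps_twist xi.

(** For [m = 1] this is [S(E^k)]; larger [m] gives the factors into which the double sums split. *)
Definition twisted_sum (m k : nat) : fps K :=
  \sum_(0 <= a < d * m) fps_const (chi a%:Z) * E ^+ (k * a).

Lemma chi_periodic a m : chi (a + d * m)%:Z = chi a%:Z.
Proof.
elim: m => [|m IHm]; first by rewrite muln0 addn0.
by rewrite mulnS addnCA addnC PoszD chi_per IHm.
Qed.

(** The range splits into [m] blocks of length [d]; by periodicity of [chi] the block of index [i]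
    is [E^(d k i) S(E^k)], and the geometric sum telescopes. *)
Lemma twisted_sum_geometric m k :
  (E ^+ (d * k) - 1) * twisted_sum m k =
  (E ^+ (d * k * m) - 1) * twisted_sum 1 k.
Proof.
elim: m => [|m IHm].
  by rewrite /twisted_sum !muln0 big_nil expr0 subrr mulr0 mul0r.
(* The last block is split off and its index shifted by [d m]. *)
have -> : twisted_sum m.+1 k =
    twisted_sum m k + E ^+ (d * k * m) * twisted_sum 1 k.
  rewrite /twisted_sum muln1 mulnS addnC.
  rewrite (@big_cat_nat _ _ _ (d * m)) ?leq_addr //=; congr (_ + _).
  rewrite -{1}[(d * m)%N]add0n big_addn addKn mulr_sumr.
  apply: eq_bigr => a _; rewrite chi_periodic mulrCA -exprD; congr (_ * _ ^+ _).
  ring.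
rewrite mulrDr IHm mulnS exprD; ring.
Qed.

Lemma fps_eval_den x w :
  fps_eval x w%:R (bernoulli_den d (xi ^+ w)) = E ^+ (d * w) - 1.
Proof.
apply/funext => n; rewrite [RHS]/GRing.add /= /fps_add (coef_fps_twistX charK).
rewrite /fps_eval /bernoulli_den /fps_exp.
rewrite -[X in _ *: (_ *: X ^+ _)]polyC_natr -polyC_exp.
rewrite hornerD hornerN !hornerZ hornerC -polyC_natr hornerC -exprM.
rewrite [X in _ = _ + X]/GRing.opp /= /fps_opp mulrBr; congr (_ - _).
  by rewrite mulnC natrM exprMn; ring.
by case: n => [|n]; rewrite ?mulr0 ?mulr1.
Qed.

(** The factor [w] comes from substituting [w t] for the leading [t]; it later absorbs the [-1] in
    the exponent [n - 1]. *)
Lemma fps_eval_num x w :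
  fps_eval x w%:R (bernoulli_num d chi (xi ^+ w)) =
  fps_const w%:R * (fps_t K : fps K) * fps_expc (w%:R * x) * twisted_sum 1 w.
Proof.
rewrite /bernoulli_num !fps_evalM; congr (_ * _ * _).
- apply/funext => n; rewrite [RHS]coef_fps_constM /fps_eval /fps_t.
  rewrite -polyC_natr hornerC.
  by case: n => [|[|n]]; rewrite ?mulr0 ?expr1.
- apply/funext => n; rewrite /fps_eval /fps_exp hornerZ hornerXn /fps_expc.
  by rewrite exprMn; ring.
- apply/funext => n; rewrite /twisted_sum muln1 coef_fps_sum /fps_eval.
  rewrite horner_sum mulr_sumr; apply: eq_bigr => a _.
  rewrite [RHS]coef_fps_constM (coef_fps_twistX charK) hornerZ /fps_exp.
  rewrite -[X in (_ *: X ^+ _)]polyC_natr -polyC_exp hornerZ hornerC.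
  by rewrite -exprM natrM exprMn; ring.
Qed.

(** The substitution is multiplicative, so it carries over the defining identity with its
    denominator cleared. *)
Lemma fps_eval_bernoulli x w :
  (E ^+ (d * w) - 1) *
    fps_eval x w%:R
      (fun n => n`!%:R^-1 *: twisted_bernoulli d chi (xi ^+ w) n) =
  fps_const w%:R * (fps_t K : fps K) * fps_expc (w%:R * x) * twisted_sum 1 w.
Proof.
have := twisted_bernoulliP charK chi (xi ^+ w) d_gt0.
by move=> /funext/(congr1 (fps_eval x w%:R)); rewrite fps_evalM fps_eval_den
  fps_eval_num.
Qed.

(** * Generating function of the double sum and its cyclic symmetry *)

Section Symmetry.
Variables (y : K) (w1 w2 w3 : nat).
Hypotheses (w1_gt0 : (0 < w1)%N) (w2_gt0 : (0 < w2)%N).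

Definition bernoulli_double_sum (n : nat) : K :=
  ((w1 * w2)%:R : K) ^ (n%:Z - 1) *
    (\sum_(0 <= a < d * w1) \sum_(0 <= b < d * w2)
       chi (a * b)%:Z * xi ^+ (w3 * (a * w2 + b * w1)) *
       (twisted_bernoulli d chi (xi ^+ (w1 * w2)) n).[
          w3%:R * y + w3%:R / w1%:R * a%:R + w3%:R / w2%:R * b%:R]).

Lemma bernoulli_double_sum_gf :
  (E ^+ (d * (w1 * w2)) - 1) *
    ((fun n => n`!%:R^-1 * bernoulli_double_sum n) : fps K) =
  (fps_t K : fps K) * fps_expc ((w1 * w2 * w3)%:R * y) * twisted_sum 1 (w1 * w2)
    * twisted_sum w1 (w2 * w3) * twisted_sum w2 (w3 * w1).
Proof.
have w10 := natf_neq0_pchar charK w1_gt0; have w20 := natf_neq0_pchar charK w2_gt0.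
set w := (w1 * w2)%N.
have w0 : w%:R != 0 :> K by rewrite natf_neq0_pchar // muln_gt0 w1_gt0.
pose x a b : K := w3%:R * y + w3%:R / w1%:R * a%:R + w3%:R / w2%:R * b%:R.
pose G a b := fps_eval (x a b) w%:R
  (fun n => n`!%:R^-1 *: twisted_bernoulli d chi (xi ^+ w) n).
(* In [w^(n-1) = w^-1 w^n], the power [w^n] is the scaling of [t] by [w] and [w^-1] stays as a
   constant. The integer exponent covers [n = 0]. *)
have -> : ((fun n => n`!%:R^-1 * bernoulli_double_sum n) : fps K) =
    \sum_(0 <= a < d * w1) \sum_(0 <= b < d * w2)
      fps_const (w%:R^-1 * (chi (a * b)%:Z * xi ^+ (w3 * (a * w2 + b * w1)))) *
      G a b.
  apply/funext => n; rewrite coef_fps_sum /bernoulli_double_sum mulrA mulr_sumr.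
  apply: eq_bigr => a _; rewrite coef_fps_sum mulr_sumr.
  apply: eq_bigr => b _; rewrite [RHS]coef_fps_constM /G /fps_eval hornerZ.
  by rewrite -/w expfzDr // exprN1 -exprnP /x; ring.
rewrite mulr_sumr /(twisted_sum w1) mulr_sumr mulr_suml; apply: eq_bigr => a _.
rewrite mulr_sumr /(twisted_sum w2) mulr_sumr; apply: eq_bigr => b _.
rewrite mulrCA fps_eval_bernoulli.
(* Together with the same splitting of the exponent of [xi] and [chi (a b) = chi a chi b], this
   separates the term into a factor in [E^(w2 w3 a)] and one in [E^(w3 w1 b)]. *)
have -> : w%:R * x a b =
    (w1 * w2 * w3)%:R * y + (w2 * w3 * a)%:R + (w3 * w1 * b)%:R.
  by rewrite /w /x !natrM; field; rewrite w10 w20.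
have -> : (w3 * (a * w2 + b * w1) = w2 * w3 * a + w3 * w1 * b)%N by ring.
rewrite !(fps_expcD charK) !(fps_twistX charK) PoszM chiM exprD !fps_constM.
(* The [w^-1] of the prefactor cancels the [w] of the numerator. *)
have wV : fps_const w%:R^-1 * fps_const w%:R = 1 :> fps K.
  by rewrite -fps_constM mulVf.
ring: wV.
Qed.

End Symmetry.

Lemma bernoulli_double_sum_cycle y w1 w2 w3 :
    (0 < w1)%N -> (0 < w2)%N -> (0 < w3)%N ->
  bernoulli_double_sum y w1 w2 w3 =1 bernoulli_double_sum y w2 w3 w1.
Proof.
move=> w1_gt0 w2_gt0 w3_gt0 n.
have F1 := bernoulli_double_sum_gf y w3 w1_gt0 w2_gt0.
have F2 := bernoulli_double_sum_gf y w1 w2_gt0 w3_gt0.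
have n0 : n`!%:R^-1 != 0 :> K by rewrite invr_eq0 natf_neq0_pchar ?fact_gt0.
apply: (mulfI n0).
suff eqG : (fun m => m`!%:R^-1 * bernoulli_double_sum y w1 w2 w3 m) =
    (fun m => m`!%:R^-1 * bernoulli_double_sum y w2 w3 w1 m) :> fps K.
  exact: (congr1 (@^~ n) eqG).
have D_inj u v : (0 < u)%N -> (0 < v)%N ->
    injective ( *%R (E ^+ (d * (u * v)) - 1)).
  by move=> u0 v0; apply: fps_twistXB1_mulfI; rewrite // !muln_gt0 d_gt0 u0.
(* On each side one of the three denominators clears the Bernoulli series ([F1] or [F2]), and the
   other two close up the geometric sums. *)
apply: (D_inj w1 w2) => //; apply: (D_inj w2 w3) => //; apply: (D_inj w3 w1) => //.
have T1 := twisted_sum_geometric w1 (w2 * w3).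
have T2 := twisted_sum_geometric w2 (w3 * w1).
have T3 := twisted_sum_geometric w3 (w1 * w2).
(* All geometric sums thereby share the numerator [E^(d w1 w2 w3) - 1], which makes the two sides
   comparable. *)
have N1 : (d * (w2 * w3) * w1 = d * (w1 * w2 * w3))%N by ring.
have N2 : (d * (w3 * w1) * w2 = d * (w1 * w2 * w3))%N by ring.
have N3 : (d * (w1 * w2) * w3 = d * (w1 * w2 * w3))%N by ring.
have N4 : (w2 * w3 * w1 = w1 * w2 * w3)%N by ring.
rewrite {}N4 in F2; rewrite {}N1 in T1; rewrite {}N2 in T2; rewrite {}N3 in T3.
rewrite F1 [X in _ = _ * X]mulrCA F2.
transitivity ((fps_t K : fps K) * fps_expc ((w1 * w2 * w3)%:R * y) *
    twisted_sum 1 (w1 * w2) *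
    ((E ^+ (d * (w2 * w3)) - 1) * twisted_sum w1 (w2 * w3)) *
    ((E ^+ (d * (w3 * w1)) - 1) * twisted_sum w2 (w3 * w1))); first ring.
transitivity ((fps_t K : fps K) * fps_expc ((w1 * w2 * w3)%:R * y) *
    twisted_sum 1 (w2 * w3) *
    ((E ^+ (d * (w3 * w1)) - 1) * twisted_sum w2 (w3 * w1)) *
    ((E ^+ (d * (w1 * w2)) - 1) * twisted_sum w3 (w1 * w2))); last ring.
rewrite T1 T2 T3; ring.
Qed.

End TwistedBernoulli.

(** * Specialisation to the p-adic complex numbers *)

Lemma ramified_root_of_unity_neq0 (p : nat) (K : fieldType) (xi : K) :
  prime p -> ramified_root_of_unity p xi -> xi != 0.
Proof.
move=> p_prime [s _ xi1]; apply/eqP => xi0; move/eqP: xi1.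
by rewrite xi0 expr0n expn_eq0 eqn0Ngt prime_gt0 // eq_sym oner_eq0.
Qed.

Theorem theorem4p6 (R : realType) (p : nat) (p_prime : prime p)
    (C : padicComplex R p) (iota : {rmorphism algC -> C})
    (d : nat) (d_gt0 : (0 < d)%N)
    (chi : int -> algC) (chi_prim : primitive_dirichlet_character d chi)
    (xi : C) (xi_ram : ramified_root_of_unity p xi)
    (w1 w2 w3 : nat) (w1_gt0 : (0 < w1)%N) (w2_gt0 : (0 < w2)%N)
    (w3_gt0 : (0 < w3)%N)
    (n : nat) (y1 : C) (y1_int : padic_integer y1) :
  ((w1 * w2)%:R : C) ^ (n%:Z - 1) *
    (\sum_(0 <= a < d * w1) \sum_(0 <= b < d * w2)
       iota (chi (a * b)%:Z) * xi ^+ (w3 * (a * w2 + b * w1)) *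
       (twisted_bernoulli d (iota \o chi) (xi ^+ (w1 * w2)) n).[
          w3%:R * y1 + w3%:R / w1%:R * a%:R + w3%:R / w2%:R * b%:R])
  = ((w2 * w3)%:R : C) ^ (n%:Z - 1) *
    (\sum_(0 <= a < d * w2) \sum_(0 <= b < d * w3)
       iota (chi (a * b)%:Z) * xi ^+ (w1 * (a * w3 + b * w2)) *
       (twisted_bernoulli d (iota \o chi) (xi ^+ (w2 * w3)) n).[
          w1%:R * y1 + w1%:R / w2%:R * a%:R + w1%:R / w3%:R * b%:R])
  /\
  ((w2 * w3)%:R : C) ^ (n%:Z - 1) *
    (\sum_(0 <= a < d * w2) \sum_(0 <= b < d * w3)
       iota (chi (a * b)%:Z) * xi ^+ (w1 * (a * w3 + b * w2)) *
       (twisted_bernoulli d (iota \o chi) (xi ^+ (w2 * w3)) n).[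
          w1%:R * y1 + w1%:R / w2%:R * a%:R + w1%:R / w3%:R * b%:R])
  = ((w3 * w1)%:R : C) ^ (n%:Z - 1) *
    (\sum_(0 <= a < d * w3) \sum_(0 <= b < d * w1)
       iota (chi (a * b)%:Z) * xi ^+ (w2 * (a * w1 + b * w3)) *
       (twisted_bernoulli d (iota \o chi) (xi ^+ (w1 * w3)) n).[
          w2%:R * y1 + w2%:R / w3%:R * a%:R + w2%:R / w1%:R * b%:R]).
Proof.
have [[_ chiM chi_per _] _] := chi_prim.
have xi0 := ramified_root_of_unity_neq0 p_prime xi_ram.
have iM : {morph (iota \o chi : int -> C) : a b / a * b}.
  by move=> a b; rewrite /= chiM rmorphM.
have iper a : (iota \o chi) (a + d%:Z) = (iota \o chi) a :> C.
  by rewrite /= chi_per.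
have cycle := bernoulli_double_sum_cycle (@Cp_pchar R p C) d_gt0 xi0 iM iper y1.
split; first exact: cycle w1_gt0 w2_gt0 w3_gt0 n.
(* The last twist is stated as [xi ^+ (w1 * w3)], whereas the cyclic order gives [w3 * w1]. *)
by rewrite [(w1 * w3)%N]mulnC; exact: cycle w2_gt0 w3_gt0 w1_gt0 n.
Qed.
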